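(* Let $\mathcal{Q}$ be a seminormal quasi-crystal with underlying set $Q$, and let $w\in Q^*$. Then $w\ \ddot{\sim}\ w^2$ if and only if $w$ is an isolated element of $\mathcal{Q}^{*}$ and $\mathrm{wt}(w)=0$.
   Context: Root system data: $V$ a finite-dimensional real inner product space, $\alpha^\vee=\frac{2}{\langle\alpha,\alpha\rangle}\alpha$; a root system $\Phi$ with fixed simple roots $(\alpha_i)_{i\in I}$ and weight lattice $\Lambda$ (a $\mathbb{Z}$-submodule of $V$ spanning $V$, containing $\Phi$, with $\langle\lambda,\alpha^\vee\rangle\in\mathbb{Z}$ for $\alpha\in\Phi$). A quasi-crystal of type $\Phi$ is a set $Q$ with maps $\mathrm{wt}:Q\to\Lambda$, $\ddot{e}_i,\ddot{f}_i:Q\to Q\sqcup\{\bot\}$ ($\bot$ = undefined), $\ddot{\varepsilon}_i,\ddot{\varphi}_i:Q\to\mathbb{Z}\cup\{\pm\infty\}$ ($i\in I$) such that: $\ddot{\varphi}_i(x)=\ddot{\varepsilon}_i(x)+\langle\mathrm{wt}(x),\alpha_i^\vee\rangle$ (with $m+(\pm\infty)=\pm\infty$); if $\ddot{e}_i(x)\in Q$ then $\mathrm{wt}(\ddot{e}_i(x))=\mathrm{wt}(x)+\alpha_i$, $\ddot{\varepsilon}_i(\ddot{e}_i(x))=\ddot{\varepsilon}_i(x)-1$, $\ddot{\varphi}_i(\ddot{e}_i(x))=\ddot{\varphi}_i(x)+1$; if $\ddot{f}_i(x)\in Q$ then $\mathrm{wt}(\ddot{f}_i(x))=\mathrm{wt}(x)-\alpha_i$,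 $\ddot{\varepsilon}_i(\ddot{f}_i(x))=\ddot{\varepsilon}_i(x)+1$, $\ddot{\varphi}_i(\ddot{f}_i(x))=\ddot{\varphi}_i(x)-1$; $\ddot{e}_i(x)=y\iff x=\ddot{f}_i(y)$; $\ddot{\varepsilon}_i(x)=\pm\infty$ implies $\ddot{e}_i(x)=\ddot{f}_i(x)=\bot$. Seminormal: whenever $\ddot{\varepsilon}_i(x)\ne+\infty$, $\ddot{\varepsilon}_i(x)=\max\{k\ge0:\ddot{e}_i^k(x)\in Q\}$ and $\ddot{\varphi}_i(x)=\max\{k\ge0:\ddot{f}_i^k(x)\in Q\}$. A quasi-crystal isomorphism between quasi-crystals with underlying sets $X,Y$ is a bijection $\psi:X\to Y$ preserving $\mathrm{wt},\ddot{\varepsilon}_i,\ddot{\varphi}_i$ such that $\ddot{e}_i(\psi(x))$ is defined iff $\ddot{e}_i(x)$ is, and then $\psi(\ddot{e}_i(x))=\ddot{e}_i(\psi(x))$; likewise for $\ddot{f}_i$. The free quasi-crystal monoid $\mathcal{Q}^{*}$: words over $Q$ with: for the empty word, $\mathrm{wt}=0$, $\ddot{\varepsilon}_i=\ddot{\varphi}_i=0$, $\ddot{e}_i,\ddot{f}_i$ undefined; for $w=x_1\cdots x_m$ ($m\ge1$), $\mathrm{wt}(w)=\sum_k\mathrm{wt}(x_k)$, and with $p=\max\{k:\ddot{\varepsilon}_i(x_k)>0\}$, $q=\min\{l:\ddot{\varphi}_i(x_l)>0\}$: if some $\ddot{\varepsilon}_i(x_k)=+\infty$, or $p,q$ exist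 with $p>q$, then $\ddot{\varepsilon}_i(w)=\ddot{\varphi}_i(w)=+\infty$ and $\ddot{e}_i,\ddot{f}_i$ undefined on $w$; otherwise $\ddot{\varepsilon}_i(w)=\sum_k\ddot{\varepsilon}_i(x_k)$, $\ddot{\varphi}_i(w)=\sum_k\ddot{\varphi}_i(x_k)$, $\ddot{e}_i(w)$ is defined iff $p$ exists and is then $w$ with $x_p$ replaced by $\ddot{e}_i(x_p)$, and $\ddot{f}_i(w)$ is defined iff $q$ exists and is then $w$ with $x_q$ replaced by $\ddot{f}_i(x_q)$. The connected component $Q^*(w)$ is the set of words obtained from $w$ by finitely many (defined) applications of operators $\ddot{e}_i,\ddot{f}_i$, with restricted structure; $w$ is isolated if $Q^*(w)=\{w\}$. Hypoplactic congruence: $u\ddot{\sim}v$ iff there is a quasi-crystal isomorphism $Q^*(u)\to Q^*(v)$ sending $u$ to $v$. *)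

(* Defs.v *)
From HB Require Import structures.
From mathcomp Require Import all_boot all_order all_algebra sesquilinear.
From mathcomp Require Import boolp classical_sets cardinality reals constructive_ereal.

Set Implicit Arguments.
Unset Strict Implicit.
Unset Printing Implicit Defensive.

Import Order.TTheory GRing.Theory Num.Theory.

Local Open Scope ring_scope.
Local Open Scope classical_set_scope.

Section RootSystems.
Variables (R : realType) (V : vectType R) (dot : {dot V for idfun}).
Implicit Types (a b v : V) (Phi : set V).

Definition coroot a : V := (2 / dot a a) *: a.

(* Root systems need be neither reduced, nor irreducible, nor span V (as for
   type A_(n-1) in R^n); it is the weight lattice that spans V. *)
Record root_system Phi : Prop := RootSystem {
  roots_finite : finite_set Phi;
  roots_neq0 : forall a, Phi a -> a != 0;
  roots_reflection : forall a b,
    Phi a -> Phi b -> Phi (b - dot b (coroot a) *: a);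
  roots_integral : forall a b,
    Phi a -> Phi b -> exists m : int, dot b (coroot a) = m%:~R
}.

Record simple_roots Phi (I : finType) (alpha : I -> V) : Prop := SimpleRoots {
  simple_root : forall i, Phi (alpha i);
  simple_free : free [seq alpha i | i : I];
  simple_decomp : forall b, Phi b -> exists c : I -> nat,
    b = \sum_i alpha i *+ c i \/ b = - \sum_i alpha i *+ c i
}.

Record weight_lattice Phi (L : zmodClosed V) : Prop := WeightLattice {
  lattice_span : exists2 s : seq V, {subset s <= L} & <<s>>%VS = fullv;
  lattice_roots : forall a, Phi a -> a \in L;
  lattice_integral : forall v a,
    v \in L -> Phi a -> exists m : int, dot v (coroot a) = m%:~R
}.

End RootSystems.

(* The bare data of a quasi-crystal; the value None of qe and qf is the
   "undefined" symbol. *)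
Record qc_data (V I : Type) : Type := QCData {
  qcar :> Type;
  wt : qcar -> V;
  qe : I -> qcar -> option qcar;
  qf : I -> qcar -> option qcar;
  qeps : I -> qcar -> \bar int;
  qphi : I -> qcar -> \bar int
}.

Record quasi_crystal (R : realType) (V : vectType R) (dot : {dot V for idfun})
    (I : finType) (alpha : I -> V) (L : zmodClosed V) (Q : qc_data V I) : Prop :=
  QuasiCrystal {
  qc_wt : forall x : Q, wt x \in L;
  qc_phi : forall i (x : Q),
    exists2 m : int, dot (wt x) (coroot dot (alpha i)) = m%:~R
                   & qphi i x = (qeps i x + m%:E)%E;
  qc_e : forall i (x y : Q), qe i x = Some y ->
    [/\ wt y = wt x + alpha i,
        qeps i y = (qeps i x - 1%:E)%E & qphi i y = (qphi i x + 1%:E)%E];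
  qc_f : forall i (x y : Q), qf i x = Some y ->
    [/\ wt y = wt x - alpha i,
        qeps i y = (qeps i x + 1%:E)%E & qphi i y = (qphi i x - 1%:E)%E];
  qc_ef : forall i (x y : Q), qe i x = Some y <-> qf i y = Some x;
  qc_infty : forall i (x : Q), qeps i x = +oo%E \/ qeps i x = -oo%E ->
    qe i x = None /\ qf i x = None
}.

(* m is the largest k such that g can be applied k times to x *)
Definition max_iter (T : Type) (g : T -> option T) (x : T) (m : \bar int) : Prop :=
  exists k : nat,
    [/\ m = k%:Z%:E,
        isSome (iter k (obind g) (Some x)) &
        forall j : nat, isSome (iter j (obind g) (Some x)) -> (j <= k)%N].

Definition seminormal (V I : Type) (Q : qc_data V I) : Prop :=
  forall i (x : Q), qeps i x <> +oo%E ->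
    max_iter (qe i) x (qeps i x) /\ max_iter (qf i) x (qphi i x).

Definition qc_isomorphism (V I : Type) (X Y : qc_data V I) (psi : X -> Y) : Prop :=
  bijective psi /\
  (forall x, wt (psi x) = wt x) /\
  (forall i x,
    [/\ qeps i (psi x) = qeps i x, qphi i (psi x) = qphi i x,
        qe i (psi x) = omap psi (qe i x) & qf i (psi x) = omap psi (qf i x)]).

Section FreeQuasiCrystal.
Variables (V : nmodType) (I : Type) (Q : qc_data V I).
Implicit Types (i : I) (w : seq Q).

(* Positions in words are counted from 0: word_q is the first position l with
   qphi i x_l > 0 and word_p the last position k with qeps i x_k > 0. *)
Definition word_p i w : option nat :=
  let a := fun x : Q => (0%:E < qeps i x)%E in
  if has a w then Some (size w - (find a (rev w)).+1)%N else None.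

Definition word_q i w : option nat :=
  let b := fun x : Q => (0%:E < qphi i x)%E in
  if has b w then Some (find b w) else None.

Definition word_infinite i w : bool :=
  has (fun x : Q => qeps i x == +oo%E) w ||
  (if (word_p i w, word_q i w) is (Some p, Some q) then (q < p)%N else false).

Definition act_at (g : Q -> option Q) w (k : nat) : option (seq Q) :=
  obind (fun x => omap (fun y => set_nth y w k y) (g x)) (onth w k).

Definition free_qc : qc_data V I := {|
  qcar := seq Q;
  wt := fun w => \sum_(x <- w) wt x;
  qe := fun i w =>
    if word_infinite i w then None else obind (act_at (qe i) w) (word_p i w);
  qf := fun i w =>
    if word_infinite i w then None else obind (act_at (qf i) w) (word_q i w);
  qeps := fun i w =>
    if word_infinite i w then +oo%E else (\sum_(x <- w) qeps i x)%E;
  qphi := fun i w =>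
    if word_infinite i w then +oo%E else (\sum_(x <- w) qphi i x)%E
|}.

End FreeQuasiCrystal.

Section Components.
Variables (V I : Type).
Implicit Type X : qc_data V I.

Inductive component X (x : X) : set X :=
| component_refl : component x x
| component_e i y z : component x y -> qe i y = Some z -> component x z
| component_f i y z : component x y -> qf i y = Some z -> component x z.

(* The structure restricted to a subset; an operator whose value leaves the
   subset is undefined, which does not happen for a connected component. *)
Definition restrict_qc X (A : set X) : qc_data V I := {|
  qcar := set_type A;
  wt := fun x => wt (val x);
  qe := fun i x => obind insub (qe i (val x));
  qf := fun i x => obind insub (qf i (val x));
  qeps := fun i x => qeps i (val x);
  qphi := fun i x => qphi i (val x)
|}.

Definition component_qc X (x : X) : qc_data V I := restrict_qc (component x).

Definition component_base X (x : X) : component_qc x :=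
  exist _ x (mem_set (component_refl x)).

Definition isolated X (x : X) : Prop := component x = [set x].

Definition qc_congruent X (u v : X) : Prop :=
  exists2 psi : component_qc u -> component_qc v,
    qc_isomorphism psi & psi (component_base u) = component_base v.

End Components.

(* Main.v *)
(* When word_infinite fails, seminormality makes every letter contribute a
   natural number to qeps i w and qphi i w, so these are natural numbers, and
   they vanish exactly when qe i w and qf i w are undefined. Squaring doubles
   them as long as the square stays finite, so a congruence of w with w ++ w
   forces each operator to be undefined on w; conversely, squaring a word with
   no positive counts (or an infinite one) changes nothing, and the two
   components are singletons. *)
Require Import Defs.
From HB Require Import structures.
From mathcomp Require Import all_boot all_order all_algebra sesquilinear.
From mathcomp Require Import boolp classical_sets cardinality reals constructive_ereal.

Set Implicit Arguments.
Unset Strict Implicit.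
Unset Printing Implicit Defensive.

Import Order.TTheory GRing.Theory Num.Theory.

Local Open Scope ring_scope.
Local Open Scope classical_set_scope.

Lemma isSome_iter_obind (T : Type) (g : T -> option T) (k : nat) (x : T) :
  isSome (iter k.+1 (obind g) (Some x)) -> isSome (g x).
Proof.
rewrite iterSr /=; case: (g x) => [//|].
by have -> : iter k (obind g) None = None by elim: k => //= k ->.
Qed.

Section Letters.
Variables (V : nmodType) (I : Type) (Q : qc_data V I) (i : I).
(** The pair [g], [m] stands for [qe i], [qeps i] or for [qf i], [qphi i], so that both operators
    are treated at once. *)
Variables (g : Q -> option Q) (m : Q -> \bar int).
Hypothesis max_g : forall x, qeps i x <> +oo%E -> max_iter g x (m x).

Lemma defined_letter (x : Q) :
  qeps i x <> +oo%E -> (0%:E < m x)%E -> isSome (g x).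
Proof.
move=> fin_x; case: (max_g fin_x) => -[|k] [-> defk _]; first by rewrite ltxx.
by move=> _; apply: isSome_iter_obind defk.
Qed.

Lemma sum_letters (w : seq Q) : all (fun x : Q => qeps i x != +oo%E) w ->
  exists2 k : nat, (\sum_(x <- w) m x)%E = k%:Z%:E
                 & has (fun x : Q => (0%:E < m x)%E) w = (0 < k)%N.
Proof.
elim: w => [|x w IHw] /=; first by exists 0%N; rewrite ?big_nil.
case/andP=> /eqP fin_x /IHw[l suml hasl]; have [k [mxk _ _]] := max_g fin_x.
exists (k + l)%N; first by rewrite big_cons mxk suml -EFinD PoszD.
by rewrite mxk hasl addn_gt0 lte_fin ltz_nat.
Qed.

(** [Q] has no distinguished element to serve as default for [nth], hence the quantified [x0]; as
    [k < size w], all its instances name the same letter. *)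
Lemma isSome_act_at (w : seq Q) (k : nat) :
  all (fun x : Q => qeps i x != +oo%E) w -> (k < size w)%N ->
  (forall x0, (0%:E < m (nth x0 w k))%E) -> isSome (act_at g w k).
Proof.
case: w => [//|x0 w]; set s := x0 :: w => fin_s ltks /(_ x0) mk.
rewrite /act_at (onthE s k) (nth_map x0) //=.
have /defined_letter/(_ mk): qeps i (nth x0 s k) <> +oo%E.
  by apply/eqP; have /all_nthP/(_ k ltks) := fin_s; apply.
by case: (g _).
Qed.

End Letters.

(** Comparing both words at position [k] reduces a fixed word to a fixed letter, which weights can
    then rule out. *)
Lemma act_at_fixed (V : nmodType) (I : Type) (Q : qc_data V I)
    (g : Q -> option Q) (w : seq Q) (k : nat) :
  act_at g w k = Some w -> exists x, g x = Some x.
Proof.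
rewrite /act_at; case Ex: (onth w k) => [x|//] /=.
case Ey: (g x) => [y|//] /= [Ew]; exists x; rewrite Ey; congr Some.
have := congr1 (fun s => onth s k) Ew; rewrite Ex => -[].
rewrite onthE (nth_map y) ?nth_set_nth /= ?eqxx; first by case.
by rewrite size_set_nth leq_max ltnSn.
Qed.

Section Words.
Variables (V : nmodType) (I : Type) (Q : qc_data V I) (hsn : seminormal Q).
Variable i : I.
Implicit Type w : free_qc Q.

Lemma word_finite w :
  ~~ word_infinite i w -> all (fun x : Q => qeps i x != +oo%E) w.
Proof. by rewrite negb_or -all_predC => /andP[]. Qed.

(** The clause on [has] is recorded because it passes to [w ++ w] and there decides whether [word_p]
    exists. *)
Lemma free_qeps w : ~~ word_infinite i w ->
  exists k : nat, [/\ qeps i w = k%:Z%:E,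
    has (fun x : Q => (0%:E < qeps i x)%E) w = (0 < k)%N
    & isSome (qe i w) = (0 < k)%N].
Proof.
move=> finw; have fin_letters := word_finite finw.
have max_e (x : Q) : qeps i x <> +oo%E -> max_iter (qe i) x (qeps i x).
  by move=> fin_x; have [] := hsn fin_x.
have [k sumk hask] := sum_letters max_e fin_letters.
exists k; rewrite /= (negPf finw); split=> //; rewrite -hask /word_p.
case: ifP => //= has_w.
have lt_w : (find (fun x : Q => 0%:E < qeps i x)%E (rev w) < size w)%N.
  by rewrite -(size_rev w) -has_find has_rev.
apply: (isSome_act_at max_e) => // [|x0].
  by rewrite ltn_subrL (leq_trans _ lt_w).
(* The last positive letter of [w] is the first one of [rev w], where [nth_find] applies. *)
by rewrite -nth_rev //; rewrite -has_rev in has_w; have /= := nth_find x0 has_w.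
Qed.

Lemma free_qphi w : ~~ word_infinite i w ->
  exists k : nat, [/\ qphi i w = k%:Z%:E,
    has (fun x : Q => (0%:E < qphi i x)%E) w = (0 < k)%N
    & isSome (qf i w) = (0 < k)%N].
Proof.
move=> finw; have fin_letters := word_finite finw.
have max_f (x : Q) : qeps i x <> +oo%E -> max_iter (qf i) x (qphi i x).
  by move=> fin_x; have [] := hsn fin_x.
have [k sumk hask] := sum_letters max_f fin_letters.
exists k; rewrite /= (negPf finw); split=> //; rewrite -hask /word_q.
case: ifP => //= has_w.
apply: (isSome_act_at max_f) => // [|x0]; first by rewrite -has_find.
by have /= := nth_find x0 has_w.
Qed.

(** In [w ++ w] the first position with positive [qphi i] stays in the left copy, while the last one
    with positive [qeps i] moves to the right copy, so an inversion [q < p] survives. *)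
Lemma word_infinite_square w :
  word_infinite i w -> word_infinite i (w ++ w).
Proof.
rewrite /word_infinite has_cat => /orP[->//|]; rewrite /word_p /word_q !has_cat.
case: ifP => // has_p; case: ifP => // has_q lt_qp.
apply/orP; right; rewrite /= rev_cat !find_cat has_rev has_p has_q size_cat.
by apply: leq_trans lt_qp _; rewrite leq_sub2r // leq_addr.
Qed.

Lemma undefined_of_square w :
  qeps i (w ++ w : free_qc Q) = qeps i w ->
  qphi i (w ++ w : free_qc Q) = qphi i w ->
  qe i w = None /\ qf i w = None.
Proof.
case: (boolP (word_infinite i w)) => [/= -> //|finw].
have [k [epsk _ ek]] := free_qeps finw.
have [l [phil _ fl]] := free_qphi finw.
move: (epsk) (phil); rewrite /= (negPf finw) => sumk suml.
(* An infinite square is excluded at once: its [qeps i] would be [+oo], but it equals the natural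
   number [k]. *)
rewrite !big_cat /= sumk suml; case: ifP => // _.
have dup0 (n : nat) : (n%:Z%:E + n%:Z%:E = n%:Z%:E)%E -> n = 0%N.
  by rewrite -EFinD -PoszD => -[/eqP]; rewrite -{3}(addn0 n) eqn_add2l => /eqP.
move=> /dup0 k0 /dup0 l0; move: ek fl; rewrite k0 l0 /= (negPf finw).
by do 2 case: obind => //.
Qed.

Lemma square_of_undefined w :
  qe i w = None -> qf i w = None ->
  [/\ qeps i (w ++ w : free_qc Q) = qeps i w,
      qphi i (w ++ w : free_qc Q) = qphi i w,
      qe i (w ++ w : free_qc Q) = None & qf i (w ++ w : free_qc Q) = None].
Proof.
case: (boolP (word_infinite i w)) => [infw _ _|finw].
  by rewrite /= infw (word_infinite_square infw).
have [k [epsk hask ek]] := free_qeps finw.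
have [l [phil hasl fl]] := free_qphi finw.
move=> ew fw; rewrite ew in ek; rewrite fw in fl.
have k0 : k = 0%N by case: k ek {epsk hask}.
have l0 : l = 0%N by case: l fl {phil hasl}.
move: epsk phil hask hasl; rewrite k0 l0 /= (negPf finw) => epsk phil hask hasl.
(* With no letter of positive [qeps i] there is no [word_p], hence no inversion; only a letter with
   infinite [qeps i] could make the square infinite, and [w] has none. *)
have -> : word_infinite i (w ++ w) = false.
  rewrite /word_infinite /word_p !has_cat hask orbF.
  by move: finw; rewrite negb_or => /andP[/negPf->].
by rewrite !big_cat /= /word_p /word_q !has_cat hask hasl /= epsk phil adde0.
Qed.

End Words.

Lemma isolated_of_undefined (V I : Type) (X : qc_data V I) (x : X) :
  (forall i, qe i x = None /\ qf i x = None) -> isolated x.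
Proof.
move=> undef; apply/seteqP; split=> y /=; last by move=> ->; apply: component_refl.
by elim=> // i {}y z _ -> ; have [e0 f0] := undef i; rewrite ?e0 ?f0.
Qed.

(** Both components are singletons, so the constant map is a bijection and only the data at the two
    base points need to agree. *)
Lemma isolated_congruent (V I : Type) (X : qc_data V I) (u v : X) :
  isolated u -> isolated v -> wt u = wt v ->
  (forall i, [/\ qeps i u = qeps i v, qphi i u = qphi i v,
     qe i u = None /\ qf i u = None & qe i v = None /\ qf i v = None]) ->
  qc_congruent u v.
Proof.
move=> iso_u iso_v wt_uv str_uv.
have single (z : X) : isolated z -> forall y : component_qc z, y = component_base z.
  move=> iso_z [y yP]; apply: val_inj => /=.
  by have := set_mem yP; rewrite iso_z.
exists (fun=> component_base v) => //; split; last split.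
- by exists (fun=> component_base u) => y; apply/esym/single.
- by move=> x; rewrite (single _ iso_u x).
move=> i x; rewrite (single _ iso_u x) /=.
by have [-> -> [-> ->] [-> ->]] := str_uv i.
Qed.

Theorem theorem7p6 (R : realType) (V : vectType R) (dot : {dot V for idfun})
    (Phi : set V) (I : finType) (alpha : I -> V) (L : zmodClosed V)
    (hPhi : root_system dot Phi) (halpha : simple_roots Phi alpha)
    (hL : weight_lattice dot Phi L)
    (Q : qc_data V I) (hQ : quasi_crystal dot alpha L Q) (hsn : seminormal Q)
    (w : free_qc Q) :
  qc_congruent w (w ++ w : free_qc Q) <-> isolated w /\ wt w = 0.
Proof.
split=> [[psi [_ [wt_psi str_psi]] psi_base]|[iso_w wt_w]].
  split.
    apply: isolated_of_undefined => i.
    have [] := str_psi i (component_base w); rewrite psi_base => eps_w phi_w _ _.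
    exact: undefined_of_square.
  (* Preservation of weight at the base point reads [wt w + wt w = wt w]. *)
  have := wt_psi (component_base w); rewrite psi_base /= big_cat /=.
  by move/(canRL (addrK _)); rewrite subrr.
have alpha_neq0 i : alpha i != 0.
  exact: (roots_neq0 hPhi) (simple_root halpha i).
have undef i : qe i w = None /\ qf i w = None.
  split.
    (* Isolation alone would allow [qe i w = Some w]. That would fix some letter [x], giving
       [wt x = wt x + alpha i] against [alpha i != 0]; the same argument serves [qf i]. *)
    case Ez: (qe i w) => [z|//].
    have zw : z = w.
      suff: component w z by rewrite iso_w.
      exact: component_e (component_refl w) Ez.
    move: Ez; rewrite zw /=; case: ifP => // _.
    case: word_p => //= p /act_at_fixed[x /(qc_e hQ)[+ _ _]].
    move/esym/(canRL (addKr _)); rewrite addNr => alpha0.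
    by have := alpha_neq0 i; rewrite alpha0 eqxx.
  case Ez: (qf i w) => [z|//].
  have zw : z = w.
    suff: component w z by rewrite iso_w.
    exact: component_f (component_refl w) Ez.
  move: Ez; rewrite zw /=; case: ifP => // _.
  case: word_q => //= p /act_at_fixed[x /(qc_f hQ)[+ _ _]].
  move/esym/(canRL (addKr _)); rewrite addNr => /eqP; rewrite oppr_eq0.
  by rewrite (negPf (alpha_neq0 i)).
have square i := square_of_undefined hsn (undef i).1 (undef i).2.
apply: isolated_congruent => //.
- by apply: isolated_of_undefined => i; have [_ _ -> ->] := square i.
- by move: wt_w; rewrite /= big_cat /= => ->; rewrite addr0.
by move=> i; have [-> -> -> ->] := square i; split.
Qed.
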